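(* For all integers $\ell\geq k\geq 1$, the minimum coprime number of the disjoint union of the two odd-length cycles $C_{2k+1}$ and $C_{2\ell+1}$ is $$\mathfrak{pr}(C_{2k+1}\cup C_{2\ell+1})=2(k+\ell)+3.$$
   Context: $C_n$ is the cycle on $n$ vertices, and $G\cup H$ denotes the disjoint union of the graphs $G$ and $H$. All graphs are finite and simple. A coprime labeling of a graph $G$ of order $N$ is an assignment of distinct labels from $\{1,\ldots,m\}$, for some integer $m\ge N$, to the vertices of $G$ such that adjacent vertices receive relatively prime labels. The minimum coprime number $\mathfrak{pr}(G)$ is the minimum value $m$ for which such a labeling exists. *)

(* Defs.v *)
From mathcomp Require Import all_boot.

Set Implicit Arguments.
Unset Strict Implicit.
Unset Printing Implicit Defensive.

Record sgraph := SGraph {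
  vertex :> finType;
  edge : rel vertex;
  edge_sym : symmetric edge;
  edge_irrefl : irreflexive edge
}.

(* [ordS i] is [i + 1] modulo [n]. For [2 < n] the condition [i != j] is
   automatic; it only keeps the degenerate cases simple. *)
Definition cycle_edge (n : nat) : rel 'I_n :=
  fun i j => (i != j) && ((j == ordS i) || (i == ordS j)).

Lemma cycle_edge_sym n : symmetric (@cycle_edge n).
Proof. by move=> i j; rewrite /cycle_edge eq_sym orbC. Qed.

Lemma cycle_edge_irrefl n : irreflexive (@cycle_edge n).
Proof. by move=> i; rewrite /cycle_edge eqxx. Qed.

Definition cycle_graph (n : nat) : sgraph :=
  SGraph (@cycle_edge_sym n) (@cycle_edge_irrefl n).

Definition union_edge (G H : sgraph) : rel (vertex G + vertex H)%type :=
  fun u v => match u, v with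
             | inl x, inl y => edge x y
             | inr x, inr y => edge x y
             | _, _ => false
             end.

Lemma union_edge_sym (G H : sgraph) : symmetric (@union_edge G H).
Proof. by move=> [x|x] [y|y] //=; rewrite edge_sym. Qed.

Lemma union_edge_irrefl (G H : sgraph) : irreflexive (@union_edge G H).
Proof. by move=> [x|x] /=; rewrite edge_irrefl. Qed.

Definition disjoint_union (G H : sgraph) : sgraph :=
  SGraph (@union_edge_sym G H) (@union_edge_irrefl G H).

(* Labels lie in {1, ..., m}, encoded as the nonzero elements of ['I_m.+1]. *)
Definition coprime_labeling (G : sgraph) (m : nat) (f : {ffun G -> 'I_m.+1}) : bool :=
  [&& [forall x, 0 < f x], injectiveb f
    & [forall x, forall y, edge x y ==> coprime (f x) (f y)]].

Definition has_coprime_labeling (G : sgraph) (m : nat) : bool :=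
  (#|G| <= m) && [exists f : {ffun G -> 'I_m.+1}, coprime_labeling f].

(* Labeling the vertices by distinct primes is always possible. *)
Lemma has_coprime_labeling_ex (G : sgraph) : exists m, has_coprime_labeling G m.
Proof.
pose p n := iter n.+1 (fun m => s2val (prime_above m)) 0.
have p_prime n : prime (p n) by rewrite /p /=; case: prime_above.
have p_step n : p n < p n.+1.
  by rewrite [p n.+1]/p iterS -/(p n); case: prime_above.
have p_mono : {homo p : i j / i < j} by apply: homo_ltn => //; apply: ltn_trans.
have p_inj : injective p.
  move=> i j eq_p; case: (ltngtP i j) => // /p_mono; by rewrite eq_p ltnn.
pose M := maxn #|G| (p #|G|).
exists M; apply/andP; split; first exact: leq_maxl.
have p_le (x : G) : p (enum_rank x) < M.+1.
  rewrite ltnS; apply: leq_trans (leq_maxr _ _); apply: ltnW.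
  exact/p_mono/ltn_ord.
apply/existsP; exists [ffun x : G => Ordinal (p_le x)].
apply/and3P; split.
- by apply/forallP => x; rewrite ffunE /=; apply: prime_gt0.
- apply/injectiveP => x y; rewrite !ffunE => /(congr1 val) /= /p_inj.
  by move/val_inj/enum_rank_inj.
- apply/forallP => x; apply/forallP => y; apply/implyP => xy.
  rewrite !ffunE /= prime_coprime // dvdn_prime2 //.
  apply: contraTneq xy => /p_inj/val_inj/enum_rank_inj ->.
  by rewrite edge_irrefl.
Qed.

Definition min_coprime_number (G : sgraph) : nat :=
  ex_minn (has_coprime_labeling_ex G).

(* Main.v *)
Require Import Defs.
From mathcomp Require Import all_boot.
From mathcomp Require Import zify.

(** Write [n = k + l].  The graph has [2 * n + 2] vertices.

    Lower bound.  Even labels are never coprime to each other, so they sit on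
    an independent set, and an independent set of a cycle of length [2 * k + 1]
    has at most [k] elements.  Hence at least [n + 2] labels are odd, and the
    [n + 2]-nd odd number is [2 * n + 3].

    Upper bound.  Consecutive integers are coprime, and 1 is coprime to
    everything.  So the short cycle receives an interval [a, ..., a + 2 * k],
    and the long one receives the rest of [1, ..., 2 * n + 3] in increasing
    order, except for one even number next to the interval.  If [b] is the last
    label before the jump, then [b] is [a - 2] or [a - 1], and in both cases
    the jump goes from [b] to [b + (2 * k + 3)].  Two conditions remain: [a] is
    coprime to [2 * k], which closes the short cycle, and [b] is coprime to
    [2 * k + 3].  The long cycle closes at the label 1, so [b] must be positive.

    Take for [a] the least odd number above 1 that is coprime to [k]; since
    [2 * k + 1] is such a number, [a <= 2 * k + 1], and as [k <= l] the interval
    ends before [2 * n + 3].  A prime that divides both [b] and [2 * k + 3] is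
    odd and less than [a], so it divides [k] by minimality of [a], hence it
    divides 3 ([jump_coprime]).  Thus only 3 can obstruct, and it cannot divide
    both [a - 2] and [a - 1] ([interval_choice]). *)

(** An independent set and its rotation by one step are disjoint sets of the
    same size. *)
Lemma cycle_independent_card n (A : pred 'I_n) :
  (forall i, A i -> ~~ A (ordS i)) -> #|A|.*2 <= n.
Proof.
move=> indA; pose S := [set i | A i].
have dis : [disjoint S & [set ordS i | i in S]].
  apply/pred0P => j /=; apply/negbTE/negP => /andP[+ /imsetP[i + def_j]].
  rewrite !inE => Aj Ai; have := indA i Ai.
  by rewrite -def_j Aj.
have cS : #|S| = #|A| by apply: eq_card => i; rewrite inE.
have := max_card (mem (S :|: [set ordS i | i in S])).
rewrite card_ord; apply: leq_trans.
by rewrite cardsU disjoint_setI0 // cards0 subn0 card_imset ?cS ?addnn //; apply: ordS_inj.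
Qed.

Lemma ordS_neq n (i : 'I_n) : 1 < n -> i != ordS i.
Proof.
move=> n_gt1; apply/eqP => /(congr1 val) /=.
have [lt_in|ge_in] := ltnP i.+1 n; first by rewrite modn_small //; lia.
have -> : i.+1 = n by have := ltn_ord i; lia.
by rewrite modnn; lia.
Qed.

Lemma cycle_edge_ordS n (i : 'I_n) : 1 < n -> cycle_edge i (ordS i).
Proof. by move=> n_gt1; rewrite /cycle_edge ordS_neq // eqxx. Qed.

Lemma even_not_coprime m n : ~~ odd m -> ~~ odd n -> ~~ coprime m n.
Proof.
rewrite -!dvdn2 => m2 n2; apply/negP => /eqP gcd1.
by have : 2 %| gcdn m n; [rewrite dvdn_gcd m2 | rewrite gcd1].
Qed.

(** Halving embeds the odd numbers up to [m] into the first [uphalf m] numbers. *)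
Lemma injective_odd_card (T : finType) m (f : T -> 'I_m.+1) :
  injective f -> #|[pred x | odd (f x)]| <= uphalf m.
Proof.
move=> inj_f; pose S := [pred x | odd (f x)].
have bound (u : {x | S x}) : (f (val u))./2 < uphalf m.
  by case: u => x /= odd_fx; have := ltn_ord (f x); move: odd_fx; rewrite /S /=; lia.
have : injective (fun u => Ordinal (bound u)).
  move=> [x Sx] [y Sy] /(congr1 val) /= eq_half.
  apply/val_inj/inj_f/val_inj => /=.
  by move: Sx Sy; rewrite /S /= => Sx Sy; lia.
by move/leq_card; rewrite card_ord card_sig.
Qed.

Lemma cycle_odd_labels k (g : 'I_(2 * k + 1) -> nat) : 0 < k ->
  (forall i j, cycle_edge i j -> coprime (g i) (g j)) -> k < #|[pred i | odd (g i)]|.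
Proof.
move=> k_gt0 cop_g; pose O := [pred i | odd (g i)].
have evens : #|[predC O]|.*2 <= 2 * k + 1.
  apply: cycle_independent_card => i /= ev_i; apply/negP => ev_j.
  have := even_not_coprime _ _ ev_i ev_j.
  by rewrite cop_g //; apply: cycle_edge_ordS; lia.
have total : #|O| + #|[predC O]| = 2 * k + 1 := etrans (cardC O) (card_ord _).
suff : k < #|O| by []; lia.
Qed.

Lemma odd_cycles_labeling_lower k l m : 0 < k -> 0 < l ->
  has_coprime_labeling
    (disjoint_union (cycle_graph (2 * k + 1)) (cycle_graph (2 * l + 1))) m ->
  2 * (k + l) + 3 <= m.
Proof.
move=> k_gt0 l_gt0 /andP[_ /existsP[f /and3P[_ /injectiveP inj_f edge_f]]].
have cop x y : edge x y -> coprime (f x) (f y).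
  by move: edge_f => /forallP /(_ x) /forallP /(_ y) /implyP.
have odd1 := cycle_odd_labels k (fun i => f (inl i)) k_gt0 (fun i j => cop (inl i) (inl j)).
have odd2 := cycle_odd_labels l (fun i => f (inr i)) l_gt0 (fun i j => cop (inr i) (inr j)).
have : k.+1 + l.+1 <= uphalf m.
  apply: leq_trans (injective_odd_card _ _ _ inj_f).
  rewrite -[leqRHS]sum1_card big_sumType /= !sum1_card.
  exact: leq_add.
lia.
Qed.

(** A prime [q] dividing [b] and [2 * k + 3] would be an odd number below [a], so
    it would divide [k], and then 3. *)
Lemma jump_coprime k a b :
  (forall c, odd c -> 1 < c < a -> ~~ coprime c k) ->
  0 < b < a -> ~~ (3 %| b) -> coprime b (2 * k + 3).
Proof.
move=> min_a /andP[b_gt0 lt_ba] b3; apply: contraNT b3 => gcd_neq1.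
have gcd_gt1 : 1 < gcdn b (2 * k + 3).
  by rewrite ltn_neqAle eq_sym gcd_neq1 gcdn_gt0 b_gt0.
have q_prime := pdiv_prime gcd_gt1; have := pdiv_dvd (gcdn b (2 * k + 3)).
set q := pdiv _ in q_prime *; rewrite dvdn_gcd => /andP[q_b q_jump].
have q_odd : odd q by apply: dvdn_odd q_jump _; lia.
have q_k : q %| k.
  rewrite -[_ %| _]negbK -prime_coprime //; apply: min_a => //.
  by rewrite prime_gt1 //; apply: leq_ltn_trans lt_ba; apply: dvdn_leq.
have q_3 : q %| 3 by rewrite -(dvdn_addr 3 (dvdn_mull 2 q_k)).
by rewrite -(eqP (_ : q == 3)) // -dvdn_prime2.
Qed.

(** The short cycle starts its interval at [a], and the long cycle jumps over it
    from [b].  The bounds on [b] say that [b] is [a - 2] or [a - 1], and that it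
    is small enough for labels to remain beyond the interval. *)
Lemma interval_choice k : 0 < k -> exists a b,
  [/\ odd a, coprime a k, 0 < b < a, a <= b + 2 <= 2 * k + 2
    & coprime b (2 * k + 3)].
Proof.
move=> k_gt0; pose P c := [&& 1 < c, odd c & coprime c k].
have P_witness : P (2 * k + 1).
  by apply/and3P; split; [lia | lia | rewrite /coprime gcdnC gcdnMDl gcdn1].
case: (ex_minnP (ex_intro P _ P_witness)) => a /and3P[a_gt1 a_odd a_cop] min_a.
have a_le := min_a _ P_witness.
have min_a' c : odd c -> 1 < c < a -> ~~ coprime c k.
  move=> c_odd /andP[c_gt1 lt_ca]; apply/negP => c_cop.
  by have := min_a c; rewrite /P c_gt1 c_odd c_cop leqNgt lt_ca => /(_ isT).
(* The prime 3 divides at most one of the two candidates for [b]. *)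
exists a; case: (boolP (3 %| a - 2)) => three.
  exists a.-1; split => //; try lia.
  by apply: (jump_coprime k a) => //; lia.
exists (a - 2); split => //; try lia.
by apply: (jump_coprime k a) => //; lia.
Qed.

Lemma coprime_labeling_intro (G : sgraph) m (f : G -> nat) :
  (forall x, 0 < f x <= m) -> injective f ->
  (forall x y, edge x y -> coprime (f x) (f y)) -> has_coprime_labeling G m.
Proof.
move=> range_f inj_f cop_f; apply/andP; split.
  have bound x : (f x).-1 < m by have := range_f x; lia.
  have : injective (fun x => Ordinal (bound x)).
    move=> x y /(congr1 val) /= eq_f; apply: inj_f.
    by have := range_f x; have := range_f y; lia.
  by move/leq_card; rewrite card_ord.
have bound x : f x < m.+1 by have /andP[] := range_f x.
apply/existsP; exists [ffun x => Ordinal (bound x)]; apply/and3P; split.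
- by apply/forallP => x; rewrite ffunE; have /andP[] := range_f x.
- by apply/injectiveP => x y; rewrite !ffunE => /(congr1 val) /inj_f.
- apply/forallP => x; apply/forallP => y; apply/implyP => xy.
  by rewrite !ffunE; apply: cop_f.
Qed.

Lemma cycle_coprime n (g : nat -> nat) :
  (forall i, i.+1 < n -> coprime (g i) (g i.+1)) -> coprime (g n.-1) (g 0) ->
  forall i j : 'I_n, cycle_edge i j -> coprime (g i) (g j).
Proof.
move=> step wrap.
have next i : coprime (g (i : 'I_n)) (g (ordS i)).
  rewrite /=; have [lt_in|ge_in] := ltnP i.+1 n.
    by rewrite modn_small //; apply: step.
  have def_n : i.+1 = n by have := ltn_ord i; lia.
  by rewrite def_n modnn (_ : i = n.-1 :> nat) //; lia.
move=> i j /andP[_ /orP[] /eqP ->] //; by rewrite coprime_sym.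
Qed.

Lemma odd_cycles_labeling_upper k l : 0 < k -> k <= l ->
  has_coprime_labeling
    (disjoint_union (cycle_graph (2 * k + 1)) (cycle_graph (2 * l + 1)))
    (2 * (k + l) + 3).
Proof.
move=> k_gt0 le_kl.
have [a [b [a_odd a_k /andP[b_gt0 lt_ba] /andP[le_ab le_bk] b_jump]]] :=
  interval_choice k k_gt0.
(* The interval and one even number are left out: one of [a - 1] and
   [a + 2 * k + 1], according to whether [b] is [a - 2] or [a - 1]. *)
pose short i := a + i.
pose long i := if i < b then i.+1 else i + (2 * k + 3).
pose f (x : disjoint_union (cycle_graph (2 * k + 1)) (cycle_graph (2 * l + 1))) :=
  match x with inl i => short i | inr i => long i end.
apply: (coprime_labeling_intro _ _ f).
- by move=> [[i lt_i]|[i lt_i]]; rewrite /f /short /long /=; [lia | case: ifP; lia].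
- move=> [[i lt_i]|[i lt_i]] [[j lt_j]|[j lt_j]]; rewrite /f /short /long /= => eq_f.
  + by congr inl; apply: val_inj => /=; lia.
  + by move: eq_f; case: ifP; lia.
  + by move: eq_f; case: ifP; lia.
  + by congr inr; apply: val_inj => /=; move: eq_f; do 2 case: ifP; lia.
move=> [i|i] [j|j] //; rewrite /f /=.
  apply: cycle_coprime => [{}i _|]; first by rewrite /short addnS coprimenS.
  rewrite /short addn0 addn1 /= /coprime gcdnC gcdnDl -/(coprime _ _).
  by rewrite coprimeMr coprimen2 a_odd.
apply: cycle_coprime => [{}i _|]; last by rewrite /long b_gt0 coprimen1.
rewrite /long; have [lt_ib|ge_ib] := ltnP i b; last first.
  by rewrite ltnNge leqW //= addSn coprimenS.
case: ltnP => [_|le_bi]; first exact: coprimenS.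
have -> : i.+1 = b by lia.
by rewrite /coprime gcdnDl.
Qed.

Theorem theorem4 (k l : nat) (hk : 1 <= k) (hkl : k <= l) :
  min_coprime_number
    (disjoint_union (cycle_graph (2 * k + 1)) (cycle_graph (2 * l + 1)))
  = 2 * (k + l) + 3.
Proof.
rewrite /min_coprime_number; case: ex_minnP => m lab_m min_m.
apply/eqP; rewrite eqn_leq min_m ?odd_cycles_labeling_upper //=.
by apply: odd_cycles_labeling_lower lab_m => //; apply: leq_trans hkl.
Qed.
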